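(* Let $q$ be a positive integer and let $\Delta$ be a non-negative integer. Consider the single-depot problem (SDF): maximize $m$ over all non-negative integers $m$ and all integers $v_1,\dots,v_m$ subject to $$\sum_{i=1}^{m} v_i=\Delta,\qquad v_i+v_j\ge q+1\ \text{ for all } i,j\in\{1,\dots,m\} \text{ with } i\neq j,\qquad v_i\in\{1,\dots,q\}\ \text{ for all } i\in\{1,\dots,m\}.$$ Let $Q=\frac{q+1}{2}$. Then the optimal (maximum) value of $m$ in the SDF is $\pi(\Delta)$, where $$\pi(\Delta)=\begin{cases}\left\lceil \dfrac{\Delta}{q}\right\rceil & \text{if } \Delta\le q,\\[6pt] \left\lceil \dfrac{\Delta-q}{\lceil Q\rceil}\right\rceil+1 & \text{if } \Delta>q.\end{cases}$$
   Context: Interpretation: $m$ is the number of vehicles, $v_i$ the load of vehicle $i$, $q$ the capacity of each vehicle and $\Delta$ the total demand. For $m=0$ the sum is empty (equal to $0$) and the other constraints are vacuous. *)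

(* Defs.v *)
From HB Require Import structures.
From mathcomp Require Import all_boot all_order all_algebra.
Set Implicit Arguments.
Unset Strict Implicit.
Unset Printing Implicit Defensive.
Import Order.TTheory GRing.Theory Num.Theory.
Local Open Scope ring_scope.

(* Capacity q, total demand Delta, m vehicles, v i the load of vehicle i. *)
Definition sdf_feasible (q Delta m : nat) (v : 'I_m -> int) : Prop :=
  [/\ \sum_(i < m) v i = Delta%:Z,
      forall i j : 'I_m, i != j -> q%:Z + 1 <= v i + v j
    & forall i : 'I_m, 1 <= v i <= q%:Z].

(* p is an int, not a nat, because it is instantiated with values of
   Num.ceil. *)
Definition sdf_optimal_value (q Delta : nat) (p : int) : Prop :=
  (exists (m : nat) (v : 'I_m -> int), sdf_feasible q Delta v /\ m%:Z = p) /\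
  (forall (m : nat) (v : 'I_m -> int), sdf_feasible q Delta v -> m%:Z <= p).

Definition half_capacity (q : nat) : rat := (q%:R + 1) / 2.

Definition sdf_pi (q Delta : nat) : int :=
  if (Delta <= q)%N then Num.ceil (Delta%:R / q%:R : rat)
  else Num.ceil ((Delta%:R - q%:R) / (Num.ceil (half_capacity q))%:~R : rat) + 1.

(* Main.v *)
(* At most one load is below h = ceil ((q + 1) / 2), since two such loads sum to
   at most q.  Pairing the lightest vehicle with any other one and bounding the
   remaining m - 2 loads by h gives Delta >= q + 1 + (m - 2) h, which is the
   upper bound on m.  It is attained by m - 1 loads equal to h and one load equal
   to Delta - (m - 1) h, which then lies in [q + 1 - h, q]. *)
Require Import Defs.
From mathcomp Require Import all_boot all_order all_algebra.
From mathcomp Require Import zify.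
Import Order.TTheory GRing.Theory Num.Theory.
Local Open Scope ring_scope.

Lemma ceil_natdiv (n d k : nat) :
  (k * d < n <= k.+1 * d)%N -> Num.ceil (n%:R / d%:R : rat) = k.+1%:Z.
Proof.
move=> /andP[ltkn lenk].
have d_gt0 : (0 < d)%N by case: d ltkn lenk => // ltkn; lia.
apply: ceil_def.
have -> : k.+1%:Z - 1 = k%:Z by lia.
by rewrite -!pmulrn ltr_pdivlMr ?ler_pdivrMr ?ltr0n // -!natrM ltr_nat ler_nat ltkn.
Qed.

Lemma ceil_half_capacity (q : nat) :
  (0 < q)%N -> Num.ceil (half_capacity q) = q./2.+1%:Z.
Proof.
move=> q_gt0; rewrite /half_capacity -[1]/(1%:R) -natrD.
by apply: ceil_natdiv; lia.
Qed.

Lemma sdf_pi_small (q Delta : nat) :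
  (Delta <= q)%N -> sdf_pi q Delta = (0 < Delta)%N.
Proof.
move=> le_Dq; rewrite /sdf_pi le_Dq.
case: Delta le_Dq => [|D] le_Dq; first by rewrite mul0r ceil0.
by apply: ceil_natdiv; lia.
Qed.

(** For x > 0 the ceiling of x / h is floor((x - 1) / h) + 1; here x = Delta - q and h =
    [q./2.+1]. *)
Lemma sdf_pi_large (q Delta : nat) : (0 < q)%N -> (q < Delta)%N ->
  sdf_pi q Delta = ((Delta - q.+1) %/ q./2.+1).+2%:Z.
Proof.
move=> q_gt0 lt_qD; rewrite /sdf_pi leqNgt lt_qD /= ceil_half_capacity //.
rewrite -natrB ?(ltnW lt_qD) // -pmulrn (ceil_natdiv _ _ ((Delta - q.+1) %/ q./2.+1)).
  by lia.
have := divn_eq (Delta - q.+1) q./2.+1.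
have := ltn_pmod (Delta - q.+1) (ltn0Sn q./2).
by nia.
Qed.

Lemma sdf_demand_lb {q Delta m : nat} {v : 'I_m.+2 -> int} :
  sdf_feasible q Delta v -> (q + m * q./2.+1 < Delta)%N.
Proof.
case=> sum_v pair_v _.
have [i0 _ min_i0] := arg_minP v (isT : predT (ord0 : 'I_m.+2)).
(* By minimality of [v i0], 2 * [v j] >= [v i0 + v j] >= q + 1. *)
have ge_h (j : 'I_m.+2) : j != i0 -> q./2.+1%:Z <= v j.
  by move=> ji0; have := pair_v _ _ ji0; have := min_i0 j isT; lia.
pose j0 := lift i0 (ord0 : 'I_m.+1).
have j0i0 : j0 != i0 by rewrite eq_sym neq_lift.
have := pair_v _ _ j0i0.
have : \sum_(j < m.+2 | (j != i0) && (j != j0)) q./2.+1%:Z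
       <= \sum_(j < m.+2 | (j != i0) && (j != j0)) v j.
  by apply: ler_sum => j /andP[ji0 _]; exact: ge_h.
move: sum_v; rewrite (bigD1 i0) //= (bigD1 j0) //= sumr_const.
have -> : #|[pred j : 'I_m.+2 | (j != i0) && (j != j0)]| = m.
  have := cardC (pred2 i0 j0); rewrite card2 eq_sym j0i0 card_ord.
  rewrite (@eq_card _ (predC _) [pred j | (j != i0) && (j != j0)]); first by case.
  by move=> j; rewrite !inE negb_or.
rewrite -mulr_natr natz; move: (\sum_(_ < _ | _) _) (v i0) (v j0) => s a b.
by nia.
Qed.

(** The lower bound on [Delta] makes the exceptional load compatible with a load h; the upper bound
    keeps it within capacity. *)
Lemma sdf_feasible_large (q Delta m : nat) : (0 < q)%N ->
  (q + m * q./2.+1 < Delta <= q + m.+1 * q./2.+1)%N ->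
  exists v : 'I_m.+2 -> int, sdf_feasible q Delta v.
Proof.
move=> q_gt0 /andP[lbD ubD].
exists (fun i => if i == ord0 then Delta%:Z - (m.+1 * q./2.+1)%:Z else q./2.+1%:Z).
split=> [|i j|i].
- rewrite big_ord_recl eqxx /= sumr_const card_ord -mulr_natr natz.
  by lia.
- by case: (eqVneq i ord0) => [->|_]; case: (eqVneq j ord0) => [_|_] //= _; nia.
- by case: ifP => _; nia.
Qed.

Theorem proposition1 (q Delta : nat) (hq : (0 < q)%N) :
  sdf_optimal_value q Delta (sdf_pi q Delta).
Proof.
have [le_Dq|lt_qD] := leqP Delta q.
  rewrite sdf_pi_small //; split.
    (* One vehicle carries everything, or none is used when [Delta] is 0. *)
    exists (0 < Delta)%N, (fun=> Delta%:Z); split=> //; split.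
    - by rewrite sumr_const card_ord; case: Delta {le_Dq}.
    - by case: (0 < Delta)%N => -[[|i] lti] [[|j] ltj].
    - by case: Delta le_Dq => [_ []|D le_Dq i] //; lia.
  (* Two or more vehicles would force [Delta] > q. *)
  case=> [|[|m]] v // feas; last by have := sdf_demand_lb feas; lia.
  case: feas => sum_v _ /(_ ord0); move: sum_v; rewrite big_ord1; lia.
rewrite sdf_pi_large //; set k := (_ %/ _)%N; split.
  have [|v feas] := sdf_feasible_large q Delta k hq; last by exists k.+2, v.
  (* Euclidean division gives k h <= Delta - q - 1 < (k + 1) h, the required window. *)
  have := divn_eq (Delta - q.+1) q./2.+1.
  have := ltn_pmod (Delta - q.+1) (ltn0Sn q./2).
  by rewrite -/k; nia.
case=> [|[|m]] v // /sdf_demand_lb lbD.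
(* [lbD] amounts to m h <= Delta - q - 1, that is, m <= k. *)
by rewrite lez_nat !ltnS leq_divRL //; lia.
Qed.
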